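(* Let $n=r$ be even. The entries $(H_D^{-1})_{ab}$, $a,b=1,\dots,r^2$, of the inverse of the matrix $H_D$ are constant along the diagonals, i.e. $(H_D^{-1})_{ab}=(H_D^{-1})_{a+c,b+c}$ for all admissible $c\in\mathbb Z$, and they are given as follows: $(H_D^{-1})_{aa}=0$ and for $b>a$ $$(H_D^{-1})_{ab}=-(H_D^{-1})_{ba}=\begin{cases}0&\text{if }[b-a]=[1],\\ 1&\text{if }[b-a]\in\{[3],[5],\dots,[r+1]\},\\ -1&\text{if }[b-a]\in\{[2],[4],\dots,[r]\},\end{cases}$$ where $[\cdot]$ denotes the class of an integer in $\mathbb Z/(r+1)\mathbb Z=\{[1],[2],\dots,[r+1]\}$.
   Context: $N_r$ is the $r\times r$ matrix with all entries on and above the diagonal equal to $-1$ and zeros below the diagonal; $M_r=-N_r^t$. For $n=r$, $H_D$ is the $r^2\times r^2$ integer skew-symmetric matrix consisting of $r\times r$ blocks, each of size $r\times r$, with diagonal blocks $0$, all blocks above the diagonal equal to $M_r$ and all blocks below the diagonal equal to $N_r$. For $n=r$ even, $H_D$ is invertible. *)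

(* Defs.v *)
From mathcomp Require Import all_boot all_order all_algebra.

Set Implicit Arguments.
Unset Strict Implicit.
Unset Printing Implicit Defensive.

Import GRing.Theory.
Local Open Scope ring_scope.

Definition N_mx (r : nat) : 'M[int]_r :=
  \matrix_(i < r, j < r) (if (i <= j)%N then -1 else 0).

Definition M_mx (r : nat) : 'M[int]_r := - (N_mx r)^T.

Lemma sum_blocks (r : nat) : (\sum_(i < r) r)%N = (r ^ 2)%N.
Proof. by rewrite sum_nat_const card_ord mulnn. Qed.

Definition H_block (r : nat) (i j : 'I_r) : 'M[int]_r :=
  if (i < j)%N then M_mx r else if (j < i)%N then N_mx r else 0.

(* [\mxblock] produces a matrix of size [\sum_(i < r) r]; it is cast to size
   [r ^ 2] without changing the position of any entry. *)
Definition H_D (r : nat) : 'M[int]_(r ^ 2) :=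
  castmx (sum_blocks r, sum_blocks r)
    (\mxblock_(i < r, j < r) H_block i j).

(* The inverse is taken over the rationals. *)
Definition H_D_rat (r : nat) : 'M[rat]_(r ^ 2) := map_mx intr (H_D r).

(* Main.v *)
Require Import Defs.
From mathcomp Require Import all_boot all_order all_algebra.
From mathcomp Require Import zify ring.

(* Write r = 2h. The candidate inverse is the Toeplitz matrix g(b - a) with
   g(n) = F(n) - F(n - 1) and F(n) = E(n) - E(n - r) for an explicit E. Inside a
   block, a row of H_D is constant on an interval of columns, so the product with
   g(c - .) telescopes within each block (through F, step 1) and then across the
   blocks (through E, step r), leaving eight values of E. These reduce to the
   Kronecker delta because E(n) - E(n - (r + 1)) = [n = 0] - [n even], because
   E(-n) = -E(n - (r + 1)), and because E(n + 2) - E(n) = -[r + 1 divides n] for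
   n >= -r. *)

Import GRing.Theory Num.Theory.
Local Open Scope ring_scope.


(** * The double primitive E and its difference equations *)

(* Two-sided solution of E(n) - E(n - (r + 1)) = [n = 0] - [n even] that vanishes on
   -r <= n <= 1, for r = 2h. *)
Definition prim2 (h : nat) (n : int) : int :=
  let s := h.*2.+1%:Z in
  ((0 <= n) && ((n %% s)%Z == 0))%:Z - (((n %/ s)%Z + 2 - (n %% 2)%Z) %/ 2)%Z.

(** In terms of quotient q and remainder t modulo r + 1, E becomes piecewise linear up to parity: r
    + 1 is odd, so n has the parity of q + t. *)
Lemma prim2_rep (h : nat) (q t : int) : 0 <= t -> t <= h%:Z * 2 ->
  prim2 h (q * h.*2.+1%:Z + t) =
  ((0 <= q) && (t == 0))%:Z - ((q + 2 - ((q + t) %% 2)%Z) %/ 2)%Z.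
Proof.
move=> t0 th; rewrite /prim2.
have s0 : h.*2.+1%:Z != 0 by [].
have tlt : 0 <= t < `|h.*2.+1%:Z| by lia.
rewrite divzMDl // modzMDl (divz_small tlt) (modz_small tlt) addr0.
have -> : ((q * h.*2.+1%:Z + t) %% 2)%Z = ((q + t) %% 2)%Z.
  have -> : q * h.*2.+1%:Z + t = q * h%:Z * 2 + (q + t) by lia.
  by rewrite modzMDl.
congr (_%:Z - _); congr nat_of_bool; case: eqP => [->|_]; last by rewrite !andbF.
by rewrite addr0 pmulr_lge0.
Qed.

Lemma prim2_split (h : nat) (n : int) :
  exists q t : int, [/\ 0 <= t, t <= h%:Z * 2 & n = q * h.*2.+1%:Z + t].
Proof.
exists (n %/ h.*2.+1%:Z)%Z, (n %% h.*2.+1%:Z)%Z; split.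
- by rewrite modz_ge0.
- by have := ltz_mod n (isT : h.*2.+1%:Z != 0); lia.
- exact: divz_eq.
Qed.

Lemma rep_ge0 (h : nat) (q t : int) : 0 <= t -> t <= h%:Z * 2 ->
  (0 <= q * h.*2.+1%:Z + t) = (0 <= q).
Proof.
move=> t0 th; have [q0|q0] := lerP 0 q; first by rewrite addr_ge0 ?mulr_ge0.
have : 0 <= (- 1 - q) * h.*2.+1%:Z by rewrite mulr_ge0 //; lia.
lia.
Qed.

Lemma rep_eq0 (h : nat) (q t : int) : 0 <= t -> t <= h%:Z * 2 ->
  (q * h.*2.+1%:Z + t == 0) = (q == 0) && (t == 0).
Proof.
move=> t0 th; have := @rep_ge0 h q t t0 th; have [->|q0] := eqVneq q 0; first lia.
have [qp|] := lerP 0 q; last by lia.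
have : 0 <= (q - 1) * h.*2.+1%:Z by rewrite mulr_ge0 //; lia.
lia.
Qed.

Lemma rep_mod2 (h : nat) (q t : int) :
  ((q * h.*2.+1%:Z + t) %% 2)%Z = ((q + t) %% 2)%Z.
Proof.
have -> : q * h.*2.+1%:Z + t = q * h%:Z * 2 + (q + t) by lia.
by rewrite modzMDl.
Qed.

(** Lowering n by r + 1 lowers q by 1 and fixes t; the floor term drops by 1 exactly for even n, and
    the indicator changes only at q = t = 0. *)
Lemma prim2_period (h : nat) (n : int) :
  prim2 h n - prim2 h (n - h.*2.+1%:Z) = (n == 0)%:Z - ((n %% 2)%Z == 0)%:Z.
Proof.
have [q [t [t0 th ->]]] := prim2_split h n.
have -> : q * h.*2.+1%:Z + t - h.*2.+1%:Z = (q - 1) * h.*2.+1%:Z + t by ring.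
rewrite !prim2_rep //.
rewrite rep_eq0 // rep_mod2.
lia.
Qed.

Lemma prim2_opp (h : nat) (n : int) :
  prim2 h (- n) = - prim2 h (n - h.*2.+1%:Z).
Proof.
have [q [t [t0 th ->]]] := prim2_split h n.
have -> : q * h.*2.+1%:Z + t - h.*2.+1%:Z = (q - 1) * h.*2.+1%:Z + t by ring.
rewrite prim2_rep //; case: (eqVneq t 0) => [->|tn0].
  have -> : - (q * h.*2.+1%:Z + 0) = (- q) * h.*2.+1%:Z + 0 by ring.
  rewrite prim2_rep //; lia.
(* For t <> 0 the remainder of - n is r + 1 - t. *)
have -> : - (q * h.*2.+1%:Z + t) = (- q - 1) * h.*2.+1%:Z + (h%:Z * 2 + 1 - t).
  lia.
rewrite prim2_rep; lia.
Qed.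

(** The lower bound forces any multiple of r + 1 among n and n + 2 to be nonnegative, so the
    one-sided indicator in E counts it. *)
Lemma prim2_step2 (h : nat) (n : int) : (0 < h)%N -> - (h%:Z * 2) <= n ->
  prim2 h (n + 2) - prim2 h n = - ((n %% h.*2.+1%:Z)%Z == 0)%:Z.
Proof.
move=> h0; have [q [t [t0 th ->]]] := prim2_split h n => nr.
have tlt : 0 <= t < `|h.*2.+1%:Z| by lia.
rewrite modzMDl (modz_small tlt).
have q0 : -1 <= q.
  have := @rep_ge0 h (q + 1) t t0 th; rewrite mulrDl mul1r. lia.
have q0t : t == 0 -> 0 <= q.
  by move=> tz; have [//|qn] := lerP 0 q;
    have q1 : q = -1; [lia | move: nr; rewrite q1; lia].
case: (lerP (t + 2) (h%:Z * 2)) => [t2|t2].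
  rewrite -[_ + t + 2]addrA !prim2_rep; lia.
have -> : q * h.*2.+1%:Z + t + 2 = (q + 1) * h.*2.+1%:Z + (t + 2 - h.*2.+1%:Z).
  ring.
rewrite !prim2_rep; lia.
Qed.

(** * The Toeplitz symbol g: oddness and values *)

Definition prim1 (h : nat) (n : int) : int := prim2 h n - prim2 h (n - h.*2%:Z).

Definition invfun (h : nat) (n : int) : int := prim1 h n - prim1 h (n - 1).

(** [prim2_period] replaces the shifts by r and r + 1 with neighbours of n: g is minus the second
    difference of E, up to indicators. *)
Lemma invfunE (h : nat) (n : int) :
  invfun h n = 2 * prim2 h n - prim2 h (n + 1) - prim2 h (n - 1)
   + (n + 1 == 0)%:Z - (n == 0)%:Z + ((n %% 2)%Z == 0)%:Z - (((n + 1) %% 2)%Z == 0)%:Z.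
Proof.
have := prim2_period h n; have := prim2_period h (n + 1); rewrite /invfun /prim1.
have -> : n + 1 - h.*2.+1%:Z = n - h.*2%:Z by lia.
have -> : n - 1 - h.*2%:Z = n - h.*2.+1%:Z by lia.
lia.
Qed.

Lemma invfunN (h : nat) (n : int) : invfun h (- n) = - invfun h n.
Proof.
have := prim2_period h n; have := prim2_period h (n + 1).
have := prim2_period h (n - 1); rewrite !invfunE.
have -> : - n + 1 = - (n - 1) by ring.
have -> : - n - 1 = - (n + 1) by ring.
rewrite !prim2_opp; lia.
Qed.

Lemma invfun0 (h : nat) : invfun h 0 = 0.
Proof. by have := invfunN h 0; rewrite oppr0; move: (invfun h 0) => x; lia. Qed.

Lemma invfun_pos (h : nat) (q t : int) : (0 < h)%N ->
  0 <= t -> t <= h%:Z * 2 -> 0 < q * h.*2.+1%:Z + t ->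
  invfun h (q * h.*2.+1%:Z + t) =
  if t == 1 then 0 else if (t == 0) || ((t %% 2)%Z == 1) then 1 else -1.
Proof.
move=> h0 t0 th npos; rewrite invfunE.
have := @rep_ge0 h q t t0 th; have := @rep_eq0 h q t t0 th => qs1 qs2.
have q0 : 0 <= q by lia.
have qt0 : t == 0 -> 0 < q by lia.
have -> : (((q * h.*2.+1%:Z + t + 1) %% 2)%Z == 0) = (((q + t + 1) %% 2)%Z == 0).
  by rewrite -!addrA rep_mod2.
rewrite rep_mod2.
have -> : (q * h.*2.+1%:Z + t + 1 == 0) = false by lia.
have -> : (q * h.*2.+1%:Z + t == 0) = false by lia.
(* The quotient changes only from n to n - 1 at t = 0 and from n to n + 1 at t = r. *)
have [tz|tz] := eqVneq t 0.
  have -> : q * h.*2.+1%:Z + t - 1 = (q - 1) * h.*2.+1%:Z + (h%:Z * 2) by lia.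
  rewrite tz -[_ + 0 + 1]addrA !prim2_rep ?eqxx /=; lia.
case: ifP => t1; last case: ifP => t2.
all: have [tm|tm] := eqVneq t (h%:Z * 2).
all: try have -> : q * h.*2.+1%:Z + t + 1 = (q + 1) * h.*2.+1%:Z + 0 by lia.
all: rewrite -?[_ + t + 1]addrA -[_ + t - 1]addrA !prim2_rep; lia.
Qed.

(** * Reduction of the eight boundary values to the Kronecker delta *)

Lemma modz_eq0N (m d : int) : ((- m %% d)%Z == 0) = ((m %% d)%Z == 0).
Proof.
by apply/eqP/eqP => /dvdz_mod0P dm; apply/dvdz_mod0P; move: dm; rewrite !dvdzE abszN.
Qed.

(* The function of k below depends only on the parity of k in -1 <= k <= r; its
   values at k = -1 and k = r follow from [prim2_period]. *)
Definition balance (h : nat) (c k : int) : int :=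
  prim2 h (h.*2%:Z * h.*2%:Z - c - h.*2%:Z + k) + prim2 h (c - k).

(** Both arguments are at least -r in this range, so [prim2_step2] applies to each; they are
    opposite modulo r + 1, hence the two jumps cancel. *)
Lemma balance_step (h : nat) (c k : int) : (0 < h)%N ->
  0 <= c < h.*2%:Z * h.*2%:Z -> -1 <= k -> k + 2 <= h.*2%:Z ->
  balance h c (k + 2) = balance h c k.
Proof.
move=> h0 /andP[c0 cr] k1 kr; rewrite /balance.
have n1 : - (h%:Z * 2) <= c - (k + 2) by lia.
have n2 : - (h%:Z * 2) <= h.*2%:Z * h.*2%:Z - c - h.*2%:Z + k by lia.
have := @prim2_step2 h _ h0 n1; have := @prim2_step2 h _ h0 n2.
have -> : c - (k + 2) + 2 = c - k by ring.
have -> : ((h.*2%:Z * h.*2%:Z - c - h.*2%:Z + k) %% h.*2.+1%:Z)%Z =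
    (- (c - (k + 2)) %% h.*2.+1%:Z)%Z.
  (* The multiplier comes from r^2 - r - 2 = (r - 2)(r + 1). *)
  rewrite -[RHS](modzMDl (h.*2%:Z - 2)); congr (_ %% _)%Z.
  by have -> : h.*2.+1%:Z = h.*2%:Z + 1; [lia | ring].
rewrite modz_eq0N [_ + (k + 2)]addrA.
move=> /eqP; rewrite subr_eq => /eqP -> /eqP; rewrite subr_eq => /eqP ->; ring.
Qed.

Lemma balance_stepn (h : nat) (c k : int) (j : nat) : (0 < h)%N ->
  0 <= c < h.*2%:Z * h.*2%:Z -> -1 <= k -> k + j.*2%:Z <= h.*2%:Z ->
  balance h c (k + j.*2%:Z) = balance h c k.
Proof.
move=> h0 cr k1; elim: j => [|j IHj] kj; first by rewrite addr0.
have -> : k + j.+1.*2%:Z = k + j.*2%:Z + 2 by lia.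
rewrite balance_step //; [apply: IHj|..]; lia.
Qed.

(** Odd k is moved down to -1 and even k up to r; one use of [prim2_period] at either end gives the
    same two values of E, up to the parity indicator. *)
Lemma balanceE (h : nat) (c : int) (k : nat) :
  0 <= c < h.*2%:Z * h.*2%:Z -> (k < h.*2)%N ->
  balance h c k = prim2 h (c - h.*2%:Z) + prim2 h (h.*2%:Z * h.*2%:Z - c - h.*2.+1%:Z)
    - (((c - k%:Z) %% 2)%Z == 0)%:Z.
Proof.
move=> cr kh; have h0 : (0 < h)%N by lia.
have := odd_double_half k; case: (odd k) => /= ek.
  have -> : k%:Z = - 1 + (k./2.+1).*2%:Z by lia.
  rewrite balance_stepn //; last lia.
  have := prim2_period h (c + 1).
  have -> : c + 1 - h.*2.+1%:Z = c - h.*2%:Z by lia.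
  rewrite /balance opprK.
  have -> : h.*2%:Z * h.*2%:Z - c - h.*2%:Z + -1 = h.*2%:Z * h.*2%:Z - c - h.*2.+1%:Z by lia.
  have -> : (((c - (-1 + (k./2.+1).*2%:Z)) %% 2)%Z == 0) = (((c + 1) %% 2)%Z == 0) by lia.
  move: (prim2 h (c + 1)) (prim2 h (c - h.*2%:Z)) => u v.
  move: (prim2 h (h.*2%:Z * h.*2%:Z - c - h.*2.+1%:Z)) => w; lia.
have := @balance_stepn h c k (h - k./2)%N h0 cr.
have -> : k%:Z + (h - k./2)%N.*2%:Z = h.*2%:Z by lia.
move=> <- //; rewrite /balance.
have := prim2_period h (h.*2%:Z * h.*2%:Z - c).
have -> : h.*2%:Z * h.*2%:Z - c - h.*2%:Z + h.*2%:Z = h.*2%:Z * h.*2%:Z - c by ring.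
have -> : (((h.*2%:Z * h.*2%:Z - c) %% 2)%Z == 0) = (((c - k%:Z) %% 2)%Z == 0).
  have -> : h.*2%:Z * h.*2%:Z - c = (h%:Z * h%:Z * 2 - k./2%:Z) * 2 - (c - k%:Z) by lia.
  by rewrite modzMDl modz_eq0N.
have -> : (h.*2%:Z * h.*2%:Z - c == 0) = false by lia.
move: (prim2 h (h.*2%:Z * h.*2%:Z - c)) (prim2 h (c - h.*2%:Z)) => u v.
move: (prim2 h (h.*2%:Z * h.*2%:Z - c - h.*2.+1%:Z)) => w; lia.
Qed.

(** [prim2_opp] reflects the two terms containing r^2, and the two terms at c - (i + 1)r cancel.
    [prim2_period] at c - k - ir then yields the delta and a parity term, which [balanceE]
    absorbs. *)
Lemma row_identity (h i k : nat) (c : int) :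
  0 <= c < h.*2%:Z * h.*2%:Z -> (k < h.*2)%N ->
  prim2 h (c - i.+1%:Z * h.*2%:Z) - prim2 h (c - h.*2%:Z * h.*2%:Z)
  - (prim2 h (c - k.+1%:Z - i.+1%:Z * h.*2%:Z)
     - prim2 h (c - k.+1%:Z - h.*2%:Z * h.*2%:Z))
  - (prim2 h (c - k%:Z) - prim2 h (c - k%:Z - i%:Z * h.*2%:Z))
  + (prim2 h (c - h.*2%:Z) - prim2 h (c - h.*2%:Z - i%:Z * h.*2%:Z))
  = (c == i%:Z * h.*2%:Z + k%:Z)%:Z.
Proof.
move=> cr kh; have := @balanceE h c k cr kh; rewrite /balance.
have -> : c - h.*2%:Z * h.*2%:Z = - (h.*2%:Z * h.*2%:Z - c) by ring.
have -> : c - k.+1%:Z - h.*2%:Z * h.*2%:Z = - (h.*2%:Z * h.*2%:Z - c + k.+1%:Z) by ring.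
rewrite !prim2_opp.
have -> : h.*2%:Z * h.*2%:Z - c + k.+1%:Z - h.*2.+1%:Z = h.*2%:Z * h.*2%:Z - c - h.*2%:Z + k%:Z.
  lia.
have -> : c - h.*2%:Z - i%:Z * h.*2%:Z = c - i.+1%:Z * h.*2%:Z by lia.
have := prim2_period h (c - k%:Z - i%:Z * h.*2%:Z).
have -> : c - k%:Z - i%:Z * h.*2%:Z - h.*2.+1%:Z = c - k.+1%:Z - i.+1%:Z * h.*2%:Z.
  lia.
(* As r is even, this parity is the one in [balanceE]. *)
have -> : ((c - k%:Z - i%:Z * h.*2%:Z) %% 2)%Z = ((c - k%:Z) %% 2)%Z.
  have -> : c - k%:Z - i%:Z * h.*2%:Z = - (i%:Z * h%:Z) * 2 + (c - k%:Z) by lia.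
  by rewrite modzMDl.
have -> : (c - k%:Z - i%:Z * h.*2%:Z == 0) = (c == i%:Z * h.*2%:Z + k%:Z) by lia.
move: (prim2 h (c - k%:Z)) (prim2 h (c - h.*2%:Z)) => u1 u2.
move: (prim2 h (c - i.+1%:Z * h.*2%:Z)) => u3.
move: (prim2 h (h.*2%:Z * h.*2%:Z - c - h.*2.+1%:Z)) => u4.
move: (prim2 h (h.*2%:Z * h.*2%:Z - c - h.*2%:Z + k%:Z)) => u5.
move: (prim2 h (c - k%:Z - i%:Z * h.*2%:Z)) => u6.
move: (prim2 h (c - k.+1%:Z - i.+1%:Z * h.*2%:Z)) => u7.
lia.
Qed.

(** * Entries of H_D and telescoping sums *)

(** Indices are natural numbers so that a sum over columns can be cut into intervals. *)
Definition H_entry (r a b : nat) : int :=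
  if (a %/ r < b %/ r)%N then ((b %% r <= a %% r)%N)%:Z
  else if (b %/ r < a %/ r)%N then - ((a %% r <= b %% r)%N)%:Z else 0.

(** [tagnat.rect] gives s as the total size of the earlier blocks plus an offset; for equal blocks
    this is Euclidean division. *)
Lemma sig_divn (r : nat) (s : 'I_(\sum_(i < r) r)) :
  nat_of_ord (tagnat.sig1 s) = (s %/ r)%N /\ nat_of_ord (tagnat.sig2 s) = (s %% r)%N.
Proof.
have := tagnat.rect s; set q := tagnat.sig1 s; set t := tagnat.sig2 s.
have qr : (q <= r)%N by apply: ltnW.
have -> : (\sum_(i < r | i < q) r = q * r)%N.
  by rewrite -(big_ord_widen r (fun=> r) qr) sum_nat_const card_ord.
move=> ->.
have r0 : (0 < r)%N by apply: leq_ltn_trans (ltn_ord q).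
by rewrite divnMDl // modnMDl divn_small ?modn_small ?addn0.
Qed.

Lemma H_DE (r : nat) (a b : 'I_(r ^ 2)) : H_D r a b = H_entry r a b.
Proof.
rewrite castmxE mxE /H_block /H_entry.
have [a1 a2] := @sig_divn r (cast_ord (esym (sum_blocks r)) a).
have [b1 b2] := @sig_divn r (cast_ord (esym (sum_blocks r)) b).
rewrite a1 b1; case: ifP => _; last case: ifP => _; rewrite !mxE //.
  by rewrite a2 b2; case: ifP; rewrite ?opprK ?oppr0.
by rewrite a2 b2; case: ifP; rewrite ?oppr0.
Qed.

Lemma sum_invfun (h : nat) (n : int) (m1 m2 : nat) : (m1 <= m2)%N ->
  \sum_(m1 <= l < m2) invfun h (n - l%:Z) = prim1 h (n - m1%:Z) - prim1 h (n - m2%:Z).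
Proof.
move=> m12; have := telescope_sumr (fun l => - prim1 h (n - l%:Z)) m12.
rewrite opprK addrC => <-.
apply: eq_bigr => l _; rewrite /invfun addrC opprK; congr (- prim1 _ _ + _); lia.
Qed.

Lemma sum_prim1 (h : nat) (n : int) (m1 m2 : nat) : (m1 <= m2)%N ->
  \sum_(m1 <= j < m2) prim1 h (n - j%:Z * h.*2%:Z) =
  prim2 h (n - m1%:Z * h.*2%:Z) - prim2 h (n - m2%:Z * h.*2%:Z).
Proof.
move=> m12; have := telescope_sumr (fun l => - prim2 h (n - l%:Z * h.*2%:Z)) m12.
rewrite opprK addrC => <-.
apply: eq_bigr => l _; rewrite /prim1 addrC opprK; congr (- prim2 _ _ + _); lia.
Qed.

(** Row k of M_r is 1 on the columns l <= k, and row k of N_r is -1 on the columns l >= k; on either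
    interval the sum of g telescopes to F. *)
Lemma sum_H_entry_block (h i j k : nat) (c : int) : (k < h.*2)%N ->
  \sum_(j * h.*2 <= b < j.+1 * h.*2) H_entry h.*2 (i * h.*2 + k) b * invfun h (c - b%:Z) =
  if (i < j)%N then prim1 h (c - j%:Z * h.*2%:Z) - prim1 h (c - k.+1%:Z - j%:Z * h.*2%:Z)
  else if (j < i)%N then
    prim1 h (c - h.*2%:Z - j%:Z * h.*2%:Z) - prim1 h (c - k%:Z - j%:Z * h.*2%:Z)
  else 0.
Proof.
move=> kr; have r0 : (0 < h.*2)%N by lia.
rewrite -{1}[(j * _)%N]add0n big_addn mulSn addnK.
under eq_big_nat => l /andP[_ lr].
  rewrite [(l + _)%N]addnC /H_entry !divnMDl // !modnMDl !divn_small // !modn_small // !addn0.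
  have -> : c - (j * h.*2 + l)%N%:Z = c - j%:Z * h.*2%:Z - l%:Z by lia.
  over.
case: (ltngtP i j) => ij.
- rewrite (big_cat_nat (n := k.+1)) //= [X in _ + X]big_nat_cond [X in _ + X]big1 ?addr0.
    under eq_big_nat => l /andP[_ lk] do rewrite -ltnS lk mul1r.
    rewrite sum_invfun // subr0; congr (_ - prim1 _ _); ring.
  by move=> l /andP[/andP[kl _] _]; rewrite leqNgt kl mul0r.
- rewrite (big_cat_nat (n := k)) //=; last exact: ltnW.
  rewrite [X in X + _]big_nat_cond [X in X + _]big1 ?add0r.
    under eq_big_nat => l /andP[kl _] do rewrite kl mulN1r.
    rewrite sumrN sum_invfun; last exact: ltnW.
    rewrite opprB; congr (prim1 _ _ - prim1 _ _); ring.
  by move=> l /andP[/andP[_ lk] _]; rewrite leqNgt lk oppr0 mul0r.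
- by apply: big1 => l _; rewrite mul0r.
Qed.

Lemma sum_H_entry (h i k : nat) (c : int) : (i < h.*2)%N -> (k < h.*2)%N ->
  \sum_(0 <= b < h.*2 * h.*2) H_entry h.*2 (i * h.*2 + k) b * invfun h (c - b%:Z) =
  prim2 h (c - i.+1%:Z * h.*2%:Z) - prim2 h (c - h.*2%:Z * h.*2%:Z)
  - (prim2 h (c - k.+1%:Z - i.+1%:Z * h.*2%:Z)
     - prim2 h (c - k.+1%:Z - h.*2%:Z * h.*2%:Z))
  - (prim2 h (c - k%:Z) - prim2 h (c - k%:Z - i%:Z * h.*2%:Z))
  + (prim2 h (c - h.*2%:Z) - prim2 h (c - h.*2%:Z - i%:Z * h.*2%:Z)).
Proof.
move=> ir kr; rewrite big_nat_mul.
under eq_bigr => j _ do rewrite sum_H_entry_block //.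
(* The diagonal block contributes 0; on each side of it the values of F advance by r and telescope
   to E. *)
rewrite (big_cat_nat (n := i)) ?(ltnW ir) //= (big_ltn ir) ltnn add0r.
rewrite [X in X + _](eq_big_nat _ _ (F2 := fun j : nat =>
  prim1 h (c - h.*2%:Z - j%:Z * h.*2%:Z) - prim1 h (c - k%:Z - j%:Z * h.*2%:Z))); last first.
  by move=> j /andP[_ ji]; rewrite ltnNge (ltnW ji) ji.
rewrite [X in _ + X](eq_big_nat _ _ (F2 := fun j : nat =>
  prim1 h (c - j%:Z * h.*2%:Z) - prim1 h (c - k.+1%:Z - j%:Z * h.*2%:Z))); last first.
  by move=> j /andP[ij _]; rewrite ij.
rewrite [X in X + _]sumrB [X in _ + X]sumrB !sum_prim1 // !mul0r !subr0.
lia.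
Qed.

(** * The inverse matrix and its entries *)

Definition toeplitz_inv (h : nat) : 'M[int]_(h.*2 ^ 2) :=
  \matrix_(a, b) invfun h (b%:Z - a%:Z).

Lemma sum_H_entry_delta (h a c : nat) : (a < h.*2 * h.*2)%N -> (c < h.*2 * h.*2)%N ->
  \sum_(0 <= b < h.*2 * h.*2) H_entry h.*2 a b * invfun h (c%:Z - b%:Z) = (a == c)%:Z.
Proof.
move=> ar cr; have r0 : (0 < h.*2)%N by case: h.*2 ar.
have ir : (a %/ h.*2 < h.*2)%N by rewrite ltn_divLR.
have kr : (a %% h.*2 < h.*2)%N by rewrite ltn_mod.
have := @sum_H_entry h _ _ c%:Z ir kr; rewrite -divn_eq => ->.
rewrite row_identity //.
by rewrite -PoszM -PoszD -divn_eq eqz_nat eq_sym.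
Qed.

Lemma H_D_mul_toeplitz_inv (h : nat) : H_D h.*2 *m toeplitz_inv h = 1%:M.
Proof.
apply/matrixP => a c; rewrite !mxE.
under eq_bigr => b _ do rewrite H_DE mxE.
rewrite -(big_mkord xpredT
  (fun b => H_entry h.*2 a b * invfun h (c%:Z - b%:Z))).
rewrite natz -val_eqE /=.
have := @sum_H_entry_delta h a c; move: (ltn_ord a) (ltn_ord c).
by move: (nat_of_ord a) (nat_of_ord c) => m n; rewrite -mulnn => mr nr; apply.
Qed.

(** A right inverse of a square matrix is its inverse, so the integral identity suffices after
    mapping to the rationals. *)
Lemma invmx_H_D_rat (h : nat) :
  H_D_rat h.*2 \in unitmx /\
  (forall a b, invmx (H_D_rat h.*2) a b = (invfun h (b%:Z - a%:Z))%:~R).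
Proof.
have HG : H_D_rat h.*2 *m map_mx intr (toeplitz_inv h) = 1%:M.
  by rewrite -map_mxM H_D_mul_toeplitz_inv map_mx1.
have [Hu _] := mulmx1_unit HG; split=> // a b.
by rewrite -[invmx _]mulmx1 -HG mulKmx // !mxE.
Qed.

(** Classes are represented here by 1, ..., r + 1, whereas division gives 0, ..., r: remainder 0
    corresponds to k = r + 1. *)
Lemma invfun_modz (h : nat) (n : int) (k : nat) : (0 < h)%N -> 0 < n ->
  (0 < k <= h.*2.+1)%N -> (n = k%:Z %[mod h.*2.+1%:Z])%Z ->
  invfun h n = if k == 1%N then 0 else if odd k then 1 else -1.
Proof.
move=> h0 n0 /andP[k0 kh] nk.
have en := divz_eq n h.*2.+1%:Z; move: n0; rewrite en nk.
case: (ltngtP k h.*2.+1) kh => // [kh _|-> _] n0.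
  have kz : (k%:Z %% h.*2.+1%:Z)%Z = k%:Z by rewrite modz_small; lia.
  move: n0; rewrite kz => n0; rewrite invfun_pos //; try lia.
  have -> : (k%:Z == 1) = (k == 1%N) by lia.
  by have -> : (k%:Z == 0) || ((k%:Z %% 2)%Z == 1) = odd k by lia.
move: n0; rewrite modzz => n0; rewrite invfun_pos //; try lia.
(* Here k = r + 1 is odd and differs from 1, so both sides are 1. *)
by rewrite eqxx /= odd_double; case: eqP => //; lia.
Qed.

Theorem proposition3p15 (r : nat) (r_even : ~~ odd r) :
  [/\ H_D_rat r \in unitmx,
      (forall (a b a' b' : 'I_(r ^ 2)) (c : int),
         a'%:Z = a%:Z + c -> b'%:Z = b%:Z + c ->
         invmx (H_D_rat r) a b = invmx (H_D_rat r) a' b'),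
      (forall a : 'I_(r ^ 2), invmx (H_D_rat r) a a = 0)
    & (forall a b : 'I_(r ^ 2), (a < b)%N ->
         [/\ invmx (H_D_rat r) a b = - invmx (H_D_rat r) b a,
             ((b%:Z - a%:Z = 1 %[mod r.+1%:Z])%Z ->
                invmx (H_D_rat r) a b = 0),
             ((exists k : nat, [/\ (3 <= k <= r.+1)%N, odd k
                 & (b%:Z - a%:Z = k%:Z %[mod r.+1%:Z])%Z]) ->
                invmx (H_D_rat r) a b = 1)
           & ((exists k : nat, [/\ (2 <= k <= r)%N, ~~ odd k
                 & (b%:Z - a%:Z = k%:Z %[mod r.+1%:Z])%Z]) ->
                invmx (H_D_rat r) a b = -1)])].
Proof.
have er : (r./2).*2 = r by rewrite even_halfK.
have [Hu invE] := invmx_H_D_rat r./2; rewrite er in Hu invE.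
split=> //.
- by move=> a b a' b' c ea eb; rewrite !invE ea eb; congr (invfun _ _)%:~R; ring.
- by move=> a; rewrite invE subrr invfun0.
(* For r = 0 there is no index a. *)
move=> a b ab; have r0 : (0 < r./2)%N.
  rewrite lt0n; apply/eqP => r0; have := ltn_ord a.
  by move: (nat_of_ord a) => m; rewrite -er r0.
have ba0 : 0 < b%:Z - a%:Z by rewrite subr_gt0 ltz_nat.
have valE k : (0 < k <= r.+1)%N -> (b%:Z - a%:Z = k%:Z %[mod r.+1%:Z])%Z ->
    invmx (H_D_rat r) a b = (if k == 1%N then 0 else if odd k then 1 else -1)%:~R.
  by move=> kr bak; rewrite invE (@invfun_modz _ _ k) // ?er.
split.
- by rewrite !invE -opprB invfunN rmorphN.
- by move=> ba; rewrite (valE 1%N).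
- case=> k [k3 ok bak]; rewrite (valE k) ?ok //; last by lia.
  by have -> : (k == 1%N) = false by lia.
- case=> k [k2 ok bak]; rewrite (valE k) ?(negPf ok) //; last by lia.
  by have -> : (k == 1%N) = false by lia.
Qed.
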